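(* Let $q$ be an odd prime power, $\delta\in\mathbb{F}_{q^2}$ and $\gamma\in\mathbb{F}_q^*$. Then the polynomial $$f(x)=(x^q-x+\delta)^{2q+3}+(x^q-x+\delta)^{5q}+\gamma x$$ is a permutation polynomial of $\mathbb{F}_{q^2}$ if and only if one of the following holds: (i) $\mathrm{Tr}_q^{q^2}(\delta)=0$; (ii) $\mathrm{Tr}_q^{q^2}(\delta)\neq0$, $3\mid q$ and $\gamma\neq\left(\mathrm{Tr}_q^{q^2}(\delta)\right)^4$; (iii) $\mathrm{Tr}_q^{q^2}(\delta)\neq0$, $q\equiv2\pmod 3$ and $\gamma=-\left(\mathrm{Tr}_q^{q^2}(\delta)\right)^4/2$.
   Context: A polynomial over a finite field $\mathbb{F}$ is a permutation polynomial of $\mathbb{F}$ if the map it induces on $\mathbb{F}$ is a bijection. For $x\in\mathbb{F}_{q^2}$, $\mathrm{Tr}_q^{q^2}(x)=x+x^q$. *)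

(* Defs.v *)
From HB Require Import structures.
From mathcomp Require Import all_boot all_order all_algebra.

Set Implicit Arguments.
Unset Strict Implicit.
Unset Printing Implicit Defensive.

Import GRing.Theory.
Local Open Scope ring_scope.

Definition prime_power (q : nat) : Prop :=
  exists p k : nat, [/\ prime p, (0 < k)%N & q = (p ^ k)%N].

Definition permutation_poly (F : finFieldType) (P : {poly F}) : Prop :=
  bijective (fun x : F => P.[x]).

(* Meant for #|F| = q ^ 2. The value lies in the subfield with q elements but
   is kept in F. *)
Definition Tr (F : finFieldType) (q : nat) (x : F) : F := x + x ^+ q.

Definition fpoly (F : finFieldType) (q : nat) (delta gamma : F) : {poly F} :=
  ('X^q - 'X + delta%:P) ^+ (2 * q + 3)%N
  + ('X^q - 'X + delta%:P) ^+ (5 * q)%N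
  + gamma *: 'X.

(* Main.v *)
(* Put s = x^q - x + delta, t = Tr delta and u = s - s^q, so that s^q = t - s and
   u^q = - u. Then 4 (f(x)^q - f(x)) equals 3 t^2 u^3 + (t^4 + 2 gamma) u up to
   an additive constant, while f(x + k) = f(x) + gamma k when k^q = k; hence f
   is a permutation iff this cubic is injective on the space {u | u^q = - u},
   which is a line over the subfield with q elements. If t = 0 or 3 | q the
   cubic is linear there. Otherwise it amounts to a cubic a v^3 + b v on the
   small field. Two distinct v, w with the same value exist as soon as b <> 0:
   up to a linear change of variables v^2 + v w + w^2 = - b / a is a diagonal
   conic, which has a point by pigeonhole. If b = 0, injectivity means that
   there is no nontrivial cube root of unity. *)

Require Import Defs.
From HB Require Import structures.
From mathcomp Require Import all_boot all_order all_algebra all_field.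
From mathcomp Require Import ring.

Import GRing.Theory.
Local Open Scope ring_scope.

(** * Counting and Frobenius in finite fields *)

(** Over [F] the polynomial X^|F| - X is the product of all X - a; mapped to [E] and evaluated at
    [x] it vanishes, so some factor [x - iota a] does. *)
Lemma fixed_by_Frobenius_in_image (F : finFieldType) (E : fieldType)
    (iota : {rmorphism F -> E}) (x : E) :
  x ^+ #|F| = x -> exists a, x = iota a.
Proof.
move=> hx; have := congr1 (fun P => (map_poly iota P).[x]) (finField_genPoly F).
rewrite rmorphB /= map_polyXn map_polyX !hornerE hx subrr rmorph_prod.
rewrite horner_prod => /esym/eqP/prodf_eq0 [a _].
by rewrite rmorphB /= map_polyX map_polyC !hornerE subr_eq0 => /eqP ->; exists a.
Qed.

Lemma card_imset_fiber2 (F : finFieldType) (h : F -> F) :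
  (forall x y, h x = h y -> y = x \/ y = - x) -> (#|F| <= 2 * #|h @: F|)%N.
Proof.
move=> hh; rewrite -[#|F|]sum1_card (partition_big_imset h) /= mulnC -sum_nat_const.
apply: leq_sum => _ /imsetP [x _ ->]; rewrite sum1dep_card.
apply: leq_trans (_ : #|[set x; - x]| <= 2)%N; last by rewrite cards2; case: eqP.
apply/subset_leq_card/subsetP => y; rewrite !inE => /eqP hy.
by have [->|->] := hh _ _ (esym hy); rewrite eqxx ?orbT.
Qed.

(** The values of [a * x ^+ 2] and those of [N - b * y ^+ 2] each fill at least half of [F], hence
    more than half as |F| is odd, so the two sets meet. *)
Lemma binary_quadratic_represents (F : finFieldType) (a b N : F) :
  odd #|F| -> a != 0 -> b != 0 -> exists x y, a * x ^+ 2 + b * y ^+ 2 = N.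
Proof.
move=> oF a0 b0.
have sq (x y : F) : x ^+ 2 = y ^+ 2 -> y = x \/ y = - x.
  by move=> /esym/eqP; rewrite eqf_sqr => /orP [] /eqP; [left|right].
have hA : (#|F| <= 2 * #|[set (a * x ^+ 2)%R | x in F]|)%N.
  by apply: card_imset_fiber2 => x y /(mulfI a0)/sq.
have hB : (#|F| <= 2 * #|[set (N - b * y ^+ 2)%R | y in F]|)%N.
  by apply: card_imset_fiber2 => x y /addrI/oppr_inj/(mulfI b0)/sq.
set A := _ @: _ in hA; set B := _ @: _ in hB.
have [/eqP AB0|[z]] := set_0Vmem (A :&: B).
  have := max_card (mem (A :|: B)); rewrite cardsU (eqP AB0) cards0 subn0 => hU.
  have hs : (2 * #|F| <= 2 * (#|A| + #|B|))%N by rewrite mulnDr mul2n -addnn leq_add.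
  have e : (#|A| + #|B|)%N = #|F|.
    by apply/eqP; rewrite eqn_leq hU; rewrite leq_pmul2l in hs.
  have o2 (n : nat) : (#|F| <= 2 * n)%N -> (#|F| < 2 * n)%N.
    rewrite leq_eqVlt => /orP [/eqP e2|//].
    by move: oF; rewrite e2 mul2n odd_double.
  by have := leq_add (o2 _ hA) (o2 _ hB); rewrite -mulnDr e addnS addSn addnn mul2n ltnNge leqnSn.
rewrite inE => /andP [/imsetP [x _ ->] /imsetP [y _ e]].
by exists x, y; rewrite e subrK.
Qed.

Lemma natr_finField_neq0 (F : finFieldType) (l : nat) :
  prime l -> ~~ (l %| #|F|)%N -> l%:R != 0 :> F.
Proof.
move=> pl; apply: contra => l0.
have lF : l \in [pchar F] by rewrite inE pl.
have := card_pprimeChar lF; rewrite -[#|_|]/#|F|.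
case: (logn _ _) => [e|n ->]; last by rewrite expnS dvdn_mulr.
by have := finNzRing_gt1 F; rewrite e.
Qed.

Lemma exprD_pchar_pow (F : finFieldType) (p k : nat) (x y : F) :
  prime p -> p \in [pchar F] -> (x + y) ^+ (p ^ k) = x ^+ (p ^ k) + y ^+ (p ^ k).
Proof.
move=> pp pF; apply: exprDn_pchar.
by rewrite pnatX (eq_pnat _ (pcharf_eq pF)) pnat_id.
Qed.

(** * Injective cubics over a finite field *)

Lemma cubic_inj_linear_coef (F : finFieldType) (a b : F) :
  odd #|F| -> 3 %:R != 0 :> F -> a != 0 ->
  injective (fun v => a * v ^+ 3 + b * v) -> b = 0.
Proof.
move=> oF n3 a0 inj; apply/eqP; apply: contraT => b0.
have n2 : 2%:R != 0 :> F by rewrite natr_finField_neq0 // dvdn2 oF.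
(* With v = (p + d)/2 and w = (p - d)/2, v^2 + v w + w^2 = (3 p^2 + d^2)/4, which has to equal
   -b/a. *)
have [p [d e]] :=
  binary_quadratic_represents F _ _ (- (4%:R * (b / a))) oF n3 (oner_neq0 F).
have eb : 4%:R * b = - a * (3%:R * p ^+ 2 + d ^+ 2).
  by rewrite -[d ^+ 2]mul1r e; field.
have n4 : 4%:R != 0 :> F by rewrite (natrM _ 2 2) mulf_neq0.
have [d0|d0] := eqVneq d 0; last first.
  have /inj e' : a * ((p + d) / 2%:R) ^+ 3 + b * ((p + d) / 2%:R)
              = a * ((p - d) / 2%:R) ^+ 3 + b * ((p - d) / 2%:R).
    have -> : b = - a * (3%:R * p ^+ 2 + d ^+ 2) / 4%:R by rewrite -eb; field.
    by field; rewrite n2 n4.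
  have : (p + d) / 2%:R - (p - d) / 2%:R = d by field.
  by rewrite e' subrr => /esym/eqP; rewrite (negPf d0).
(* When d = 0, p/2 is a double root of a v^3 + b v - const, so the roots sum
   to zero with -p as the third one. *)
have p0 : p != 0.
  apply: contraNneq b0 => p0; move: eb; rewrite p0 d0 !expr0n /= mulr0 addr0 mulr0.
  by move/eqP; rewrite mulf_eq0 (negPf n4).
have /inj e' : a * (p / 2%:R) ^+ 3 + b * (p / 2%:R) = a * (- p) ^+ 3 + b * - p.
  have -> : b = - a * (3%:R * p ^+ 2 + d ^+ 2) / 4%:R by rewrite -eb; field.
  by rewrite d0; field; rewrite n2 n4.
have : 3%:R * p = 2%:R * (p / 2%:R - (- p)) by field.
by rewrite e' subrr mulr0 => /eqP; rewrite mulf_eq0 (negPf n3) (negPf p0).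
Qed.

(** If |F| = 3m + 1, each nonzero x has (x^m)^3 = 1, so injectivity forces x^m = 1: X^m - 1 would
    have 3m roots. *)
Lemma cube_inj_card (F : finFieldType) :
  injective (fun v : F => v ^+ 3) -> #|F| <> 1 %[mod 3].
Proof.
move=> inj; have F1 := finNzRing_gt1 F.
move=> /eqP; rewrite eqn_mod_dvd 1?ltnW // => /dvdnP [m em].
have m0 : (0 < m)%N by case: m em => // /eqP; rewrite subn_eq0 leqNgt F1.
have sz : size ('X^m - 1 : {poly F}) = m.+1 by rewrite size_Xn_sub_1.
have p0 : 'X^m - 1 != 0 :> {poly F} by rewrite -size_poly_eq0 sz.
have := @max_poly_roots F _ (enum [set~ 0]) p0.
rewrite enum_uniq sz -cardE cardsC1 -subn1 em => h.
suff : (m * 3 < m.+1)%N by rewrite ltnS leqNgt -{1}[m]muln1 ltn_mul2l m0.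
apply: h => //; apply/allP => x; rewrite mem_enum !inE => x0.
rewrite rootE !hornerE subr_eq0; apply/eqP/inj; rewrite expr1n -exprM -em.
by apply: (mulfI x0); rewrite -exprS subn1 prednK ?expf_card ?mulr1 // ltnW.
Qed.

(** * Reduction to a cubic on the trace-zero line *)

Definition trace_zero_cubic (F : fieldType) (t gamma u : F) : F :=
  3%:R * t ^+ 2 * u ^+ 3 + (t ^+ 4 + 2%:R * gamma) * u.

Lemma fpoly_perm_iff_cubic_inj (F : finFieldType) (q : nat) (delta gamma : F) :
  odd q -> 2%:R != 0 :> F ->
  (forall x y : F, (x + y) ^+ q = x ^+ q + y ^+ q) ->
  (forall x : F, x ^+ q ^+ q = x) ->
  gamma ^+ q = gamma -> gamma != 0 ->
  permutation_poly (fpoly q delta gamma) <->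
  {in [pred u : F | u ^+ q == - u] &,
    injective (trace_zero_cubic F (Tr q delta) gamma)}.
Proof.
move=> oq n2 hD hqq gq g0; set G := trace_zero_cubic _ _ _.
have hN (x : F) : (- x) ^+ q = - x ^+ q by rewrite exprNn -signr_odd oq expr1 mulN1r.
have hB (x y : F) : (x - y) ^+ q = x ^+ q - y ^+ q by rewrite hD hN.
pose s (x : F) := x ^+ q - x + delta; pose t := Tr q delta.
have sq x : s x ^+ q = t - s x by rewrite [in LHS]/s hD hB hqq /t /Tr /s; ring.
have tq : t ^+ q = t by rewrite /t /Tr hD hqq addrC.
have fE x : (fpoly q delta gamma).[x] =
    s x ^+ 3 * (t - s x) ^+ 2 + (t - s x) ^+ 5 + gamma * x.
  transitivity (s x ^+ (2 * q + 3) + s x ^+ (5 * q) + gamma * x).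
    by rewrite /fpoly !hornerE.
  rewrite exprD (mulnC 2%N) (mulnC 5%N) ![s x ^+ (q * _)]exprM sq.
  by rewrite [_ ^+ 2 * _]mulrC.
(* Substitute s = (t + u)/2 and s^q = (t - u)/2: the u^5 terms cancel, and the factor 4 clears the
   remaining denominators. *)
have key x : 4%:R * ((fpoly q delta gamma).[x] ^+ q - (fpoly q delta gamma).[x])
    = G (s x - (t - s x)) + 2%:R * gamma * (t - 2%:R * delta).
  rewrite fE !hD !exprMn gq hB tq sq /G /trace_zero_cubic -/t.
  by rewrite -(subrK x (x ^+ q)) -(addrK delta (x ^+ q - x)) -/(s x); ring.
have sU x : s x - (t - s x) \in [pred u : F | u ^+ q == - u].
  by rewrite inE !hB tq sq; apply/eqP; ring.
have n4 : 4%:R != 0 :> F by rewrite (natrM _ 2 2) mulf_neq0.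
split=> [/bij_inj inj u w|inj].
  have lift v : v \in [pred u : F | u ^+ q == - u] -> exists x, s x - (t - s x) = v.
    (* The goal amounts to x^q - x = r; since r^q = -r, x = -r/2 is a solution. *)
    rewrite inE => /eqP vq; pose r := (t + v) / 2%:R - delta.
    have h2 (y : F) : (y / 2%:R) ^+ q = y ^+ q / 2%:R.
      by rewrite exprMn exprVn mulr2n hD expr1n.
    have rq : r ^+ q = - r.
      rewrite {1}/r hB h2 hD tq vq /r (_ : delta ^+ q = t - delta); first by field.
      by rewrite /t /Tr; ring.
    have sr : s (- (r / 2%:R)) = (t + v) / 2%:R.
      by rewrite /s hN h2 rq /r; field.
    by exists (- (r / 2%:R)); rewrite sr; field.
  move=> /lift [x <-] /lift [y <-] e.
  (* This shift gives x + k the same value as y; k^q = k because, by [key], f^q - f agrees at x and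
     y. *)
  pose k := ((fpoly q delta gamma).[y] - (fpoly q delta gamma).[x]) / gamma.
  have kq : k ^+ q = k.
    rewrite exprMn exprVn gq hB; congr (_ / _); apply/eqP.
    rewrite -subr_eq0 -(mulrI_eq0 _ (mulfI n4)); apply/eqP.
    set X := _.[x] in key e *; set Y := _.[y] in key e *.
    transitivity (4%:R * (Y ^+ q - Y) - 4%:R * (X ^+ q - X)); first by ring.
    by rewrite /X /Y !key e subrr.
  have sk : s (x + k) = s x by rewrite /s hD kq; ring.
  have /inj <- : (fpoly q delta gamma).[x + k] = (fpoly q delta gamma).[y].
    by rewrite fE sk mulrDr addrA -fE /k; field.
  by rewrite sk.
apply: injF_bij => x y e.
have es : s x = s y.
  have : G (s x - (t - s x)) = G (s y - (t - s y)).
    by apply: (addIr (2%:R * gamma * (t - 2%:R * delta))); rewrite -!key e.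
  move=> /(inj _ _ (sU x) (sU y)) h; apply: (mulfI n2).
  transitivity (s x - (t - s x) + t); first by ring.
  by rewrite h; ring.
by move: e; rewrite !fE es => /addrI /(mulfI g0).
Qed.

Lemma trace_zero_cubic_inj_iff (Fq E : finFieldType)
    (iota : {rmorphism Fq -> E}) (t eps : E) (gamma : Fq) :
  odd #|Fq| -> ~~ (3 %| #|Fq|)%N -> t ^+ #|Fq| = t -> t != 0 ->
  eps ^+ #|Fq| = - eps -> eps != 0 ->
  {in [pred u : E | u ^+ #|Fq| == - u] &,
    injective (trace_zero_cubic E t (iota gamma))} <->
  #|Fq| = 2 %[mod 3] /\ t ^+ 4 + 2%:R * iota gamma = 0.
Proof.
move=> oq d3 tq t0 eq0 eps0.
have n3F : 3%:R != 0 :> Fq by rewrite natr_finField_neq0.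
have n3 : 3%:R != 0 :> E by rewrite -(rmorph_nat iota) fmorph_eq0.
set q := #|Fq| in oq d3 tq eq0 *.
have inE' (u : E) : (u \in [pred u : E | u ^+ q == - u]) = (u ^+ q == - u) by [].
split=> [inj|[q2 b0] u w].
  have [t' et] := fixed_by_Frobenius_in_image _ _ iota t tq.
  (* As eps^2 is Frobenius-fixed, u = eps * iota v turns the cubic into eps times one with
     coefficients in [Fq]. *)
  have [c ec] : exists c, eps ^+ 2 = iota c.
    by apply: fixed_by_Frobenius_in_image; rewrite exprAC eq0 sqrrN.
  pose a := 3%:R * t' ^+ 2 * c; pose b := t' ^+ 4 + 2%:R * gamma.
  have GE v : trace_zero_cubic E t (iota gamma) (eps * iota v)
      = eps * iota (a * v ^+ 3 + b * v).
    rewrite /a /b !(rmorph_nat, rmorphD, rmorphM, rmorphXn) /= -ec -et.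
    by rewrite /trace_zero_cubic; ring.
  have inj' : injective (fun v => a * v ^+ 3 + b * v).
    move=> v w e; apply: (fmorph_inj iota); apply: (mulfI eps0).
    have U z : eps * iota z \in [pred u : E | u ^+ q == - u].
      by rewrite inE' exprMn eq0 -rmorphXn expf_card mulNr.
    by apply: inj; rewrite ?U // !GE e.
  have b0 : b = 0.
    apply: cubic_inj_linear_coef oq _ _ inj'.
      exact: n3F.
    rewrite -(fmorph_eq0 iota) /a 2!rmorphM rmorphXn rmorph_nat -et -ec.
    by rewrite !mulf_neq0 // ?expf_neq0.
  split.
    have : #|Fq| <> 1 %[mod 3].
      by apply: cube_inj_card => v w e; apply: inj'; rewrite /= b0 !mul0r e.
    move: d3; rewrite /dvdn -/q; have := ltn_pmod q (isT : 0 < 3)%N.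
    by case: (q %% 3)%N => [|[|[|]]].
  by rewrite et -(rmorph0 iota) -b0 /b rmorphD rmorphM !rmorphXn rmorph_nat.
rewrite !inE' => /eqP uq /eqP wq; rewrite /trace_zero_cubic b0 !mul0r !addr0.
have a0 : 3%:R * t ^+ 2 != 0 by rewrite mulf_neq0 ?expf_neq0.
move=> /(mulfI a0) e.
have [w0|w0] := eqVneq w 0.
  by move/eqP: e; rewrite w0 expr0n expf_eq0 /= => /eqP.
(* z = u / w satisfies z^3 = 1 and z = z^q = z^2. *)
have z3 : (u / w) ^+ 3 = 1 by rewrite exprMn exprVn e divff ?expf_neq0.
have zq : (u / w) ^+ q = u / w by rewrite exprMn exprVn uq wq invrN mulrNN.
have z0 : u / w != 0 by apply: contra_eq_neq z3 => ->; rewrite expr0n eq_sym oner_eq0.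
have z1 : u / w = 1.
  apply: (mulfI z0); rewrite mulr1 -[RHS]zq (divn_eq q 3) q2 exprD mulnC exprM z3.
  by rewrite expr1n mul1r.
by rewrite -[u](divfK w0) z1 mul1r.
Qed.

(* Fq2 is the field with q ^ 2 elements; its subfield with q elements is the
   image of Fq under the embedding iota. *)
Theorem theorem3p10 (q : nat) (hq : prime_power q) (hodd : odd q)
    (Fq Fq2 : finFieldType) (hFq : #|Fq| = q) (hFq2 : #|Fq2| = (q ^ 2)%N)
    (iota : {rmorphism Fq -> Fq2})
    (delta : Fq2) (gamma : Fq) (hgamma : gamma <> 0) :
  permutation_poly (fpoly q delta (iota gamma)) <->
  [\/ Tr q delta = 0,
      [/\ Tr q delta <> 0, (3 %| q)%N & iota gamma <> Tr q delta ^+ 4]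
    | [/\ Tr q delta <> 0, q = 2 %[mod 3]
        & iota gamma = - (Tr q delta ^+ 4 / 2%:R)]].
Proof.
have [p [k [pp _ eq]]] := hq.
have pF : p \in [pchar Fq2].
  by apply: card_finPcharP pp; rewrite hFq2 eq -expnM.
have hD (x y : Fq2) : (x + y) ^+ q = x ^+ q + y ^+ q by rewrite eq exprD_pchar_pow.
have hqq (x : Fq2) : x ^+ q ^+ q = x by rewrite -exprM mulnn -hFq2 expf_card.
have n2 : 2%:R != 0 :> Fq2 by rewrite natr_finField_neq0 // hFq2 dvdn2 oddX hodd.
have gq : iota gamma ^+ q = iota gamma by rewrite -rmorphXn -hFq expf_card.
have g0 : iota gamma != 0 by rewrite fmorph_eq0; apply/eqP.
have tq : Tr q delta ^+ q = Tr q delta by rewrite /Tr hD hqq addrC.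
rewrite (fpoly_perm_iff_cubic_inj Fq2 q delta _ hodd n2 hD hqq gq g0).
(* Take x^q - x for an x not fixed by Frobenius; were all x fixed, [iota] would be onto, against the
   cardinalities. *)
have [eps eq0 eps0] : exists2 e : Fq2, e ^+ q = - e & e != 0.
  have [/forallP fixed|] := boolP [forall x : Fq2, x ^+ q == x].
    have := leq_image_card iota Fq; rewrite hFq leqNgt => /negP [].
    apply: leq_trans (_ : #|Fq2| <= _)%N.
      by rewrite hFq2 -{1}[q]expn1 ltn_exp2l // -hFq finNzRing_gt1.
    apply/subset_leq_card/subsetP => x _.
    have [|a ->] := fixed_by_Frobenius_in_image _ _ iota x.
      by rewrite hFq; apply/eqP.
    exact: image_f.
  case/forallPn => x x0; exists (x ^+ q - x); last by rewrite subr_eq0.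
  by rewrite hD exprNn -signr_odd hodd expr1 mulN1r hqq opprB.
set t := Tr q delta in tq *.
have [t0|t0] := eqVneq t 0.
  split=> [_|_]; first by apply: Or31.
  move=> u w _ _; rewrite /trace_zero_cubic t0 !expr0n /= !(mulr0, mul0r, add0r).
  by apply: mulfI; rewrite mulf_neq0.
have [d3|d3] := boolP (3 %| q)%N.
  have z3 : 3%:R = 0 :> Fq2.
    move: d3; rewrite eq Euclid_dvdX // dvdn_prime2 // => /andP [/eqP e3 _].
    by move: pF; rewrite -e3 => /pcharf0.
  (* In characteristic 3 the cubic term vanishes and 2 = -1. *)
  have GE u : trace_zero_cubic Fq2 t (iota gamma) u = (t ^+ 4 - iota gamma) * u.
    rewrite /trace_zero_cubic z3 !mul0r add0r; congr ((_ + _) * _).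
    by rewrite -[RHS]addr0 -(mul0r (iota gamma)) -z3; ring.
  split=> [inj|[/eqP|[_ _ gt4]|[_ q2 _]]].
  - apply: Or32; split=> //; first exact/eqP.
    move=> gt4; move/eqP: eps0; apply; apply: inj.
    + by rewrite inE eq0.
    + by rewrite inE expr0n oppr0 eqn0Ngt odd_gt0.
    + by rewrite !GE gt4 subrr !mul0r.
  - by rewrite (negPf t0).
  - move=> u w _ _; rewrite !GE; apply: mulfI.
    by rewrite subr_eq0 eq_sym; apply/eqP.
  - by move: d3; rewrite /dvdn q2.
have := trace_zero_cubic_inj_iff Fq Fq2 iota t eps gamma.
rewrite hFq => /(_ hodd d3 tq t0 eq0 eps0) ->.
split=> [[q2 b0]|].
  apply: Or33; split=> //; first exact/eqP.
  apply: (mulfI n2); rewrite -[LHS](addKr (t ^+ 4)) b0; by field.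
case=> [/eqP|[_ q3 _]|[_ q2 ->]].
- by rewrite (negPf t0).
- by case/negP: d3.
- by split=> //; field.
Qed.
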